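(* Let $P\colon\mathbb{C}^3\to\mathbb{R}$, $$P(z,w_1,w_2)=|z|^2\cdot\left(|w_1|^4+|w_1^2-w_1w_2|^2+|w_2|^4\right).$$ Then $P$ is a non-constant, homogeneous, plurisubharmonic polynomial without pluriharmonic terms, and $P$ is homogeneous in one variable separately. Furthermore, away from the coordinate hyperplanes, $P$ is pluriharmonic along the level sets of $G\colon\mathbb{C}^3\to\mathbb{C}^2$, $G(z,w_1,w_2)=(zw_1^2,zw_2^2)$. However, there do not exist a homogeneous, plurisubharmonic polynomial $Q\colon\mathbb{C}^2\to\mathbb{R}$ and holomorphic polynomials $F_1,F_2\colon\mathbb{C}^3\to\mathbb{C}$, homogeneous of the same degree, such that $P=Q\circ(F_1,F_2)$ on $\mathbb{C}^3$.
   Context: A polynomial $\mathbb{C}^n\to\mathbb{R}$ means a real-valued polynomial in the coordinates and their complex conjugates, written $\sum a_{\alpha,\beta}z^\alpha\overline{z}^\beta$; homogeneous means $\mathbb{R}$-homogeneous (all terms have the same total degree $|\alpha|+|\beta|$). ''Without pluriharmonic terms'' means that no purely holomorphic or purely anti-holomorphic terms appear, i.e. $a_{\alpha,\beta}\neq 0$ implies $|\alpha|>0$ and $|\beta|>0$. A homogeneous, plurisubharmonic, non-constant polynomial $P=\sum a_{\alpha,\beta}z^\alpha\overline{z}^\beta$ on $\mathbb{C}^n$ without pluriharmonic terms is homogeneous in $l$ variables separately if there exist integers $1\leq i_1<\dots<i_l\leq n$ and integers $d_{i_1},\dots,d_{i_l}\geq 1$ such that for every $(\alpha,\beta)$ with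 $a_{\alpha,\beta}\neq 0$ one has $\alpha_{i_j}+\beta_{i_j}=2d_{i_j}$ for $j=1,\dots,l$. ''Away from the coordinate hyperplanes, $P$ is pluriharmonic along the level sets of $G$'' means: with $U$ the open set where all coordinates are nonzero (on which $G$ is nonsingular, i.e. its complex Jacobian matrix has maximal rank), the restriction of $P$ to each level set of $G|_U$ (a complex submanifold of $U$) is pluriharmonic. *)

(* Defs.v *)
(* C^n is 'rV[R[i]]_n, for an arbitrary R : realType.  R[i]^o is R[i] viewed
   as a normed space over the field R[i]; it carries the usual topology of C. *)
From HB Require Import structures.
From mathcomp Require Import all_boot all_order all_algebra.
From mathcomp Require Import complex.
From mathcomp Require Import all_classical all_reals all_analysis.
(* The notations of mpoly clash with those of mathcomp-analysis. *)
From mathcomp Require Import -(notations) mpoly.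

Set Implicit Arguments.
Unset Strict Implicit.
Unset Printing Implicit Defensive.

Import Order.TTheory GRing.Theory Num.Theory.
Import numFieldNormedType.Exports.

Local Open Scope classical_set_scope.
Local Open Scope complex_scope.
Local Open Scope ring_scope.

Section RealPolynomials.
Variables (R : realType) (n : nat).

(* A polynomial in z and its conjugate: the variables lshift n i stand for
   z_i, the variables rshift n i for the conjugate of z_i. *)
Definition zzbar_poly := mpoly (n + n) R[i].

Definition eval_zzbar (p : zzbar_poly) (z : 'rV[R[i]]_n) : R[i] :=
  meval (row_mx z (map_mx (@conjc R) z) 0) p.

(* Such a p is unique, given f. *)
Definition expands (p : zzbar_poly) (f : 'rV[R[i]]_n -> R) : Prop :=
  forall z, eval_zzbar p z = (f z)%:C.

Definition alpha (m : multinom (n + n)) (i : 'I_n) : nat := m (lshift n i).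
Definition beta (m : multinom (n + n)) (i : 'I_n) : nat := m (rshift n i).

(* mdeg counts |alpha| + |beta|, so this is R-homogeneity. *)
Definition homogeneous_poly (p : zzbar_poly) : Prop :=
  exists d : nat, p \is ishomog1 d (@mdeg (n + n)).

Definition without_pluriharmonic_terms (p : zzbar_poly) : Prop :=
  forall m, mcoeff m p != 0 ->
    (0 < \sum_i alpha m i)%N /\ (0 < \sum_i beta m i)%N.

Definition homogeneous_in_variables (l : nat) (p : zzbar_poly) : Prop :=
  exists (i : 'I_l -> 'I_n) (d : 'I_l -> nat),
    [/\ forall j k : 'I_l, (j < k)%N -> (i j < i k)%N,
        forall j, (1 <= d j)%N &
        forall m, mcoeff m p != 0 ->
          forall j, (alpha m (i j) + beta m (i j) = 2 * d j)%N].

Definition nonconstant (f : 'rV[R[i]]_n -> R) : Prop :=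
  ~ exists c : R, forall z, f z = c.

Definition upper_semicontinuous (f : 'rV[R[i]]_n -> R) : Prop :=
  forall (a : 'rV[R[i]^o]_n) (c : R), f a < c -> \forall x \near a, f x < c.

(* Upper semicontinuous and subharmonic on every complex line, i.e. the
   sub-mean value inequality holds on every circle of every complex line. *)
Definition plurisubharmonic (f : 'rV[R[i]]_n -> R) : Prop :=
  upper_semicontinuous f /\
  forall a b : 'rV[R[i]]_n,
    ((f a)%:E <= ((2 * pi)^-1)%:E *
       \int[lebesgue_measure]_(t in `[0%R, (2 * pi)%R])
          (f (a + (cos t +i* sin t) *: b)%R)%:E)%E.

End RealPolynomials.

Section Pluriharmonic.
Variable R : realType.

(* The real partial derivatives of f, on C identified with R^2. *)
Definition partial_x (f : R[i]^o -> R) (z : R[i]^o) : R :=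
  'D_1 (fun s : R => f (s +i* complex.Im z)) (complex.Re z).
Definition partial_y (f : R[i]^o -> R) (z : R[i]^o) : R :=
  'D_1 (fun s : R => f (complex.Re z +i* s)) (complex.Im z).

Definition has_partials (f : R[i]^o -> R) (z : R[i]^o) : Prop :=
  derivable (fun s : R => f (s +i* complex.Im z)) (complex.Re z) 1 /\
  derivable (fun s : R => f (complex.Re z +i* s)) (complex.Im z) 1.

Fixpoint C_on (k : nat) (W : set R[i]^o) (f : R[i]^o -> R) : Prop :=
  (forall z, W z -> {for z, continuous f}) /\
  if k is k'.+1 then
    [/\ forall z, W z -> has_partials f z,
        C_on k' W (partial_x f) & C_on k' W (partial_y f)]
  else True.

Definition harmonic_on (W : set R[i]^o) (f : R[i]^o -> R) : Prop :=
  C_on 2 W f /\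
  forall z, W z -> partial_x (partial_x f) z + partial_y (partial_y f) z = 0.

(* derivable is taken over the field R[i]^o: complex differentiability. *)
Definition holomorphic_on (n : nat) (W : set R[i]^o) (phi : R[i]^o -> 'rV[R[i]^o]_n)
    : Prop :=
  forall t, W t -> forall i, derivable (fun s => phi s 0 i) t 1.

(* For M a complex submanifold of C^n: f is harmonic along every
   holomorphic curve in M. *)
Definition pluriharmonic_on (n : nat) (M : set 'rV[R[i]^o]_n)
    (f : 'rV[R[i]^o]_n -> R) : Prop :=
  forall (W : set R[i]^o) (phi : R[i]^o -> 'rV[R[i]^o]_n),
    open W -> holomorphic_on W phi -> (forall t, W t -> M (phi t)) ->
    harmonic_on W (f \o phi).

Definition off_coordinate_hyperplanes (n : nat) : set 'rV[R[i]^o]_n :=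
  [set x | forall i, x 0 i != 0].

Definition nonsingular_at (n k : nat) (g : 'rV[R[i]^o]_n -> 'rV[R[i]^o]_k)
    (x : 'rV[R[i]^o]_n) : Prop :=
  differentiable g x /\ \rank (jacobian g x) = minn n k.

Definition pluriharmonic_along_level_sets (n k : nat) (U : set 'rV[R[i]^o]_n)
    (f : 'rV[R[i]^o]_n -> R) (g : 'rV[R[i]^o]_n -> 'rV[R[i]^o]_k) : Prop :=
  (forall x, U x -> nonsingular_at g x) /\
  forall c : 'rV[R[i]^o]_k, pluriharmonic_on (U `&` [set x | g x = c]) f.

End Pluriharmonic.

Section Example.
Variable R : realType.

Definition holo_map (n k : nat) (F : 'I_k -> mpoly n R[i])
    (x : 'rV[R[i]]_n) : 'rV[R[i]]_k :=
  \row_j meval (x 0) (F j).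

Definition exampleP (x : 'rV[R[i]]_3) : R :=
  let z := x 0 0 in let w1 := x 0 1 in let w2 := x 0 2%:R in
  let abs := @ComplexField.Normc.normc R in
  abs z ^+ 2 * (abs w1 ^+ 4 + abs (w1 ^+ 2 - w1 * w2) ^+ 2 + abs w2 ^+ 4).

Definition exampleG (x : 'rV[R[i]]_3) : 'rV[R[i]]_2 :=
  let z := x 0 0 in let w1 := x 0 1 in let w2 := x 0 2%:R in
  \row_j [:: z * w1 ^+ 2; z * w2 ^+ 2]`_j.

End Example.

(* Main.v *)
Require Import Defs.
From HB Require Import structures.
From mathcomp Require Import all_boot all_order all_algebra.
From mathcomp Require Import complex.
From mathcomp Require Import all_classical all_reals all_analysis.
From mathcomp Require Import -(notations) mpoly.
From mathcomp Require Import ring lra.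

(** Write P = |h_0|^2 + |h_1|^2 + |h_2|^2 with the cubic holomorphic polynomials
    h_0 = z w_1^2, h_1 = z (w_1^2 - w_1 w_2), h_2 = z w_2^2.

    Plurisubharmonicity: along a complex line each h_k is a product of three
    affine functions of zeta, hence a polynomial p(zeta), and
    |p(zeta)|^2 >= |p(0)|^2 + 2 Re (conj(p(0)) (p(zeta) - p(0))).
    The second summand is a trigonometric polynomial without constant term on
    the unit circle, so it has mean value zero; this gives the sub-mean value
    inequality ([exampleP_ge], [integral_trig_poly]).

    Level sets of G: if z w_1^2 = c_1 and z w_2^2 = c_2, then P is a function
    of c_1, c_2 and s = z w_1 w_2, and s^2 = c_1 c_2. Off the coordinate
    hyperplanes s does not vanish, so along a curve contained in a level set
    the continuous function s is locally constant, and so is P. A locally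
    constant function is harmonic ([exampleP_pluriharmonic]).

    No factorization P = Q o F: let e be the degree of Q and d that of F. As P
    has degree 6, d e = 6. If e is odd then d = 2 or d = 6, so i^d = -1 and
    P(x) = P(i x) = Q(- F(x)) = - P(x), which is absurd. If d = 1, then F is a
    linear map from C^3 to C^2; its kernel contains some v <> 0, and P is
    invariant under translation by v, which the explicit formula for P forbids
    ([factor_not_linear]). There remains d = 3, e = 2. Averaging over
    x |-> - i x, which fixes P and turns F(x) into i F(x), removes from Q all
    but its sesquilinear part, so that P is a sesquilinear expression in
    (F_1, F_2). Polarizing this identity yields
    sum_k h_k(y) conj(h_k(x)) = sum_b G_b(y) conj(F_b(x)) for all x and y, where
    G_1, G_2 are linear combinations of F_1, F_2. The left-hand side is a
    kernel of rank three and the right-hand side one of rank at most two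
    ([polarization], [factor_not_quadratic]). *)

Set Implicit Arguments.
Unset Strict Implicit.
Unset Printing Implicit Defensive.

Import Order.TTheory GRing.Theory Num.Theory.
Import numFieldNormedType.Exports.

Local Open Scope classical_set_scope.
Local Open Scope complex_scope.
Local Open Scope ring_scope.

Local Notation normc := ComplexField.Normc.normc.
Local Notation normcM := ComplexField.Normc.normcM.

(** * The polynomial P as a sum of squared moduli *)

Section Basics.
Variable R : realType.
Local Notation C := R[i].

Lemma ord3P (j : 'I_3) : [\/ j = 0, j = 1 | j = 2%:R].
Proof.
by case: j => -[|[|[|//]]] lt_j;
  [constructor 1|constructor 2|constructor 3]; apply: val_inj.
Qed.

Lemma sum_ord3 (V : nmodType) (f : 'I_3 -> V) : \sum_k f k = f 0 + f 1 + f 2%:R.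
Proof.
rewrite !big_ord_recl big_ord0 addr0 addrA.
by congr (f _ + f _ + f _); apply: val_inj.
Qed.

Lemma normc_sqr (z : C) : (normc z ^+ 2)%:C = z * z^*%C.
Proof.
by case: z => a b; rewrite /= sqr_sqrtr ?addr_ge0 ?sqr_ge0 //; simpc; congr (_ +i* _); ring.
Qed.

Lemma normc_i : normc ('i : C)%C = 1.
Proof. by rewrite /= expr0n add0r expr1n sqrtr1. Qed.

Lemma exampleP_products (x : 'rV[C]_3) (z := x 0 0) (w1 := x 0 1) (w2 := x 0 2%:R) :
  exampleP x = normc (z * w1 * w1) ^+ 2 + normc (z * w1 * (w1 - w2)) ^+ 2
               + normc (z * w2 * w2) ^+ 2.
Proof.
rewrite /exampleP -/z -/w1 -/w2.
have -> : w1 ^+ 2 - w1 * w2 = w1 * (w1 - w2) by ring.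
by rewrite !normcM; ring.
Qed.

Lemma exampleP_scale (c : C) x :
  exampleP (c *: x) = normc c ^+ 6 * exampleP x.
Proof.
rewrite /exampleP !mxE.
have -> : (c * x 0 1) ^+ 2 - c * x 0 1 * (c * x 0 2%:R) =
          c ^+ 2 * (x 0 1 ^+ 2 - x 0 1 * x 0 2%:R) by ring.
by rewrite !(expr2 c) !normcM; ring.
Qed.

(** The point (a, b, c) of C^3. *)
Definition row3 (a b c : C) : 'rV[C]_3 := \row_j [:: a; b; c]`_j.

Lemma exampleP_row3 (a b c : C) :
  exampleP (row3 a b c) =
  normc a ^+ 2 * (normc b ^+ 4 + normc (b ^+ 2 - b * c) ^+ 2 + normc c ^+ 4).
Proof. by rewrite /exampleP !mxE. Qed.

Lemma exampleP_row110 : exampleP (row3 1 1 0) = 2.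
Proof.
by rewrite exampleP_row3 mulr0 subr0 !expr1n (ComplexField.Normc.normc1 R)
  (ComplexField.Normc.normc0 R) !expr1n expr0n mul1r addr0.
Qed.

Lemma exampleP_nonconstant : nonconstant (@exampleP R).
Proof.
move=> [c Pc]; have := exampleP_scale 0 (row3 1 1 0).
rewrite !Pc (ComplexField.Normc.normc0 R) expr0n mul0r => c0.
by have := exampleP_row110; rewrite Pc c0; lra.
Qed.

End Basics.

(** * The expansion of P in z and its conjugate *)

Section WeightedBidegree.
Variable n : nat.
Implicit Types (a b : 'I_n -> nat) (m : multinom (n + n)).

(** The weighted degree in which z_i has weight a_i and the conjugate of z_i has
    weight b_i; it is additive on monomials, so homogeneity for it is available
    as for the total degree. Total degree, holomorphic degree, antiholomorphic
    degree and degree in one variable are all of this form. *)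
Definition wbideg a b m : nat := (\sum_i (alpha m i * a i + beta m i * b i))%N.

Fact wbideg0 a b : wbideg a b mnm0 = 0%N.
Proof. by rewrite /wbideg big1 // => i _; rewrite /alpha /beta !mnm0E !mul0n. Qed.

Fact wbidegD a b : {morph wbideg a b : m1 m2 / mnm_add m1 m2 >-> (m1 + m2)%N}.
Proof.
move=> m1 m2; rewrite /wbideg -big_split; apply: eq_bigr => i _ /=.
by rewrite /alpha /beta !mnmDE; ring.
Qed.

HB.instance Definition _ a b := isMeasure.Build (n + n) (wbideg a b) (wbideg0 a b) (@wbidegD a b).

Lemma wbideg_lshift a b i : wbideg a b (mnm1 (lshift n i)) = a i.
Proof.
rewrite /wbideg (bigD1 i) //= big1 => [|j ji]; rewrite /alpha /beta !mnm1E.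
  by rewrite eqxx eq_lrshift mul1n mul0n !addn0.
by rewrite eq_lrshift eq_lshift eq_sym (negbTE ji).
Qed.

Lemma wbideg_rshift a b i : wbideg a b (mnm1 (rshift n i)) = b i.
Proof.
rewrite /wbideg (bigD1 i) //= big1 => [|j ji]; rewrite /alpha /beta !mnm1E.
  by rewrite eqxx eq_rlshift mul1n mul0n addn0.
by rewrite eq_rlshift eq_rshift eq_sym (negbTE ji).
Qed.

End WeightedBidegree.

Section ExpansionOfP.
Variable R : realType.
Local Notation C := R[i].
Let Z (i : 'I_3) : zzbar_poly R 3 := mpolyX C (mnm1 (lshift 3 i)).
Let Zc (i : 'I_3) : zzbar_poly R 3 := mpolyX C (mnm1 (rshift 3 i)).

(** The expansion of P; with (z_0, z_1, z_2) = (z, w_1, w_2), [Z i] is the variable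
    z_i and [Zc i] its conjugate. *)
Definition exampleP_poly : zzbar_poly R 3 :=
  Z 0 * Zc 0 * (Z 1 ^+ 2 * Zc 1 ^+ 2 + (Z 1 ^+ 2 - Z 1 * Z 2%:R) * (Zc 1 ^+ 2 - Zc 1 * Zc 2%:R)
                + Z 2%:R ^+ 2 * Zc 2%:R ^+ 2).

Lemma exampleP_poly_expands : expands exampleP_poly (@exampleP R).
Proof.
move=> x; rewrite exampleP_products !rmorphD /= !normc_sqr /eval_zzbar /exampleP_poly !expr2.
rewrite !(mevalM, mevalD, mevalN) !mevalXU !row_mxEl !row_mxEr !mxE.
move: (x 0 0) (x 0 1) (x 0 2%:R) => z w1 w2.
have cM (a b : C) : (a * b)^*%C = a^*%C * b^*%C by exact: rmorphM.
have cB (a b : C) : (a - b)^*%C = a^*%C - b^*%C by exact: rmorphB.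
by rewrite !(cM, cB); ring.
Qed.

(** P is homogeneous for every weight that does not distinguish w_1 from w_2. *)
Lemma exampleP_poly_homog (a b : 'I_3 -> nat) :
  a 1 = a 2%:R -> b 1 = b 2%:R ->
  exampleP_poly \is ishomog1 (a 0%R + b 0%R + (a 1%R * 2 + b 1%R * 2))%N (wbideg a b).
Proof.
move=> a12 b12.
have hZ i : Z i \is ishomog1 (a i) (wbideg a b).
  by rewrite dhomogX; apply/eqP/wbideg_lshift.
have hZc i : Zc i \is ishomog1 (b i) (wbideg a b).
  by rewrite dhomogX; apply/eqP/wbideg_rshift.
have hZ2 := hZ 2%:R; have hZc2 := hZc 2%:R; rewrite -a12 in hZ2; rewrite -b12 in hZc2.
have hZ11 := dhomogMn 2 (hZ 1); have hZc11 := dhomogMn 2 (hZc 1).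
apply: dhomogM; first exact: dhomogM.
apply: dhomogD; last by apply: dhomogM; exact: dhomogMn.
apply: dhomogD; first exact: dhomogM.
have e2 k : (k + k = k * 2)%N by rewrite muln2 addnn.
apply: dhomogM.
- by rewrite rpredB //; have := dhomogM (hZ 1) hZ2; rewrite (e2 (a 1)).
- by rewrite rpredB //; have := dhomogM (hZc 1) hZc2; rewrite (e2 (b 1)).
Qed.

Lemma exampleP_poly_wbideg (a b : 'I_3 -> nat) m :
  a 1 = a 2%:R -> b 1 = b 2%:R -> mcoeff m exampleP_poly != 0 ->
  wbideg a b m = (a 0%R + b 0%R + (a 1%R * 2 + b 1%R * 2))%N.
Proof.
move=> a12 b12; rewrite -mcoeff_msupp.
by move/dhomogP: (exampleP_poly_homog a12 b12); apply.
Qed.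

Lemma exampleP_poly_properties :
  [/\ homogeneous_poly exampleP_poly, without_pluriharmonic_terms exampleP_poly &
      homogeneous_in_variables 1 exampleP_poly].
Proof.
split.
- exists 6; apply/dhomogP => m; rewrite mcoeff_msupp => m0.
  rewrite -[RHS](exampleP_poly_wbideg (a := fun=> 1%N) (b := fun=> 1%N) _ _ m0) //.
  rewrite [LHS]mdegE big_split_ord /= -big_split /=.
  by apply: eq_bigr => i _; rewrite !muln1.
- move=> m m0; split.
    rewrite (_ : (\sum_i _)%N = wbideg (fun=> 1%N) (fun=> 0%N) m).
      by rewrite (exampleP_poly_wbideg _ _ m0).
    by apply: eq_bigr => i _; rewrite muln1 muln0 addn0.
  rewrite (_ : (\sum_i _)%N = wbideg (fun=> 0%N) (fun=> 1%N) m).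
    by rewrite (exampleP_poly_wbideg _ _ m0).
  by apply: eq_bigr => i _; rewrite muln1 muln0 add0n.
- exists (fun=> 0), (fun=> 1%N); split=> //; first by move=> j k; rewrite !ord1.
  (* the separate variable is z, with weight 1 on z and its conjugate *)
  move=> m m0 _; pose e (i : 'I_3) : nat := i == 0.
  rewrite -[RHS](exampleP_poly_wbideg (a := e) (b := e) _ _ m0) //.
  rewrite /wbideg (bigD1 0) //= big1 ?addn0 => [|i i0]; first by rewrite !muln1.
  by rewrite /e (negbTE i0) !muln0.
Qed.

End ExpansionOfP.

(** * Plurisubharmonicity *)

Section ComplexContinuity.
Variable R : realType.

Lemma gt0_realc (z : R[i]) : 0 < z -> exists2 r : R, 0 < r & z = r%:C.
Proof. by case: z => a b; rewrite ltcE /= => /andP[/eqP-> a0]; exists a. Qed.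

Lemma horizontal_continuous (y : R) :
  continuous (fun s : R => (s +i* y : R[i]^o)).
Proof.
move=> a; apply/cvgrPdist_lt => z /gt0_realc[r r0 ->].
near=> s; have -> : (a +i* y) - (s +i* y) = (a - s)%:C :> R[i]
  by apply/eqP; rewrite eq_complex /= subrr !eqxx.
rewrite normc_def /= expr0n addr0 sqrtr_sqr ltcR.
by near: s; exact: cvgr_dist_lt.
Unshelve. all: by end_near. Qed.

Lemma vertical_continuous (x : R) :
  continuous (fun s : R => (x +i* s : R[i]^o)).
Proof.
move=> a; apply/cvgrPdist_lt => z /gt0_realc[r r0 ->].
near=> s; have -> : (x +i* a) - (x +i* s) = 0 +i* (a - s) :> R[i]
  by apply/eqP; rewrite eq_complex /= subrr !eqxx.
rewrite normc_def /= expr0n add0r sqrtr_sqr ltcR.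
by near: s; exact: cvgr_dist_lt.
Unshelve. all: by end_near. Qed.

Lemma Re_continuous : continuous (@complex.Re R : R[i]^o -> R).
Proof.
move=> a; apply/(@cvgrPdist_lt _ R^o _ (nbhs (a : R[i]^o))) => r r0.
have rC : 0 < r%:C by rewrite ltcR.
have H : \forall z \near (a : R[i]^o), `|a - z| < r%:C.
  by apply: (@cvgr_dist_lt _ R[i]^o _ _ _ id a (@cvg_id _ _) _ rC); exact: nbhs_filter.
apply: filterS H => z; rewrite -ltcR; apply: le_lt_trans.
by rewrite -raddfB; exact: normc_ge_Re.
Qed.

Lemma normc_continuous : continuous (@normc R : R[i]^o -> R).
Proof.
have -> : (@normc R : R[i]^o -> R) = (@complex.Re R : R[i]^o -> R) \o (Num.norm : R[i]^o -> R[i]^o).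
  by apply/funext => -[a b].
by move=> z; apply: continuous_comp; [exact: norm_continuous | exact: Re_continuous].
Qed.

End ComplexContinuity.

Section Plurisubharmonic.
Variable R : realType.
Local Notation C := R[i].
(* the point exp(it) of the unit circle *)
Local Notation expi t := (cos t +i* sin t).

Lemma exampleP_continuous (T : topologicalType) (phi : T -> 'rV[C^o]_3) (t : T) :
  (forall k, {for t, continuous (fun u => phi u 0 k)}) ->
  {for t, continuous (fun u => exampleP (phi u))}.
Proof.
move=> phic.
have -> : (fun u => exampleP (phi u)) =
  (fun u => normc (phi u 0 0 * phi u 0 1 * phi u 0 1) ^+ 2) +
  (fun u => normc (phi u 0 0 * phi u 0 1 * (phi u 0 1 - phi u 0 2%:R)) ^+ 2) +
  (fun u => normc (phi u 0 0 * phi u 0 2%:R * phi u 0 2%:R) ^+ 2).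
  by apply/funext => u; rewrite exampleP_products.
have sqc (h : T -> C^o) : {for t, continuous h} ->
    {for t, continuous (fun u => normc (h u) ^+ 2)}.
  move=> hc; have nc : {for t, continuous (fun u => normc (h u))}.
    by apply: (continuous_comp hc); exact: normc_continuous.
  exact: (continuousM nc nc).
apply: continuousD; first apply: continuousD; apply: sqc.
- exact: (continuousM (continuousM (phic 0) (phic 1)) (phic 1)).
- exact: (continuousM (continuousM (phic 0) (phic 1)) (continuousB (phic 1) (phic 2%:R))).
- exact: (continuousM (continuousM (phic 0) (phic 2%:R)) (phic 2%:R)).
Qed.

(** |p_0 + w|^2 >= |p_0|^2 + 2 Re (conj(p_0) w), where p_0 is the value at
    zeta = 0 of a product of three affine functions of zeta and w is the
    remainder, a combination of zeta, zeta^2 and zeta^3. *)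
Lemma normc_mul3_ge (u0 v0 u1 v1 u2 v2 : C) : exists D1 D2 D3 : C, forall zeta : C,
  normc (u0 * u1 * u2) ^+ 2 + complex.Re (D1 * zeta + D2 * zeta ^+ 2 + D3 * zeta ^+ 3) <=
  normc ((u0 + zeta * v0) * (u1 + zeta * v1) * (u2 + zeta * v2)) ^+ 2.
Proof.
pose p0 := u0 * u1 * u2.
pose q := 2 * p0^*%C.
exists (q * (v0 * u1 * u2 + u0 * v1 * u2 + u0 * u1 * v2)).
exists (q * (v0 * v1 * u2 + v0 * u1 * v2 + u0 * v1 * v2)).
exists (q * (v0 * v1 * v2)) => z.
pose w := (u0 + z * v0) * (u1 + z * v1) * (u2 + z * v2) - p0.
have -> : q * (v0 * u1 * u2 + u0 * v1 * u2 + u0 * u1 * v2) * z +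
    q * (v0 * v1 * u2 + v0 * u1 * v2 + u0 * v1 * v2) * z ^+ 2 + q * (v0 * v1 * v2) * z ^+ 3
    = q * w by rewrite /w /p0; ring.
have -> : (u0 + z * v0) * (u1 + z * v1) * (u2 + z * v2) = p0 + w by rewrite /w; ring.
rewrite -/p0 /q -mulrA; move: p0 w {q} => [a b] [c d].
rewrite mulr_natl raddfMn /= !sqr_sqrtr ?addr_ge0 ?sqr_ge0 //.
by have := sqr_ge0 c; have := sqr_ge0 d; lra.
Qed.

Lemma exampleP_ge (a b : 'rV[C]_3) : exists D1 D2 D3 : C, forall zeta : C,
  exampleP a + complex.Re (D1 * zeta + D2 * zeta ^+ 2 + D3 * zeta ^+ 3) <=
  exampleP (a + zeta *: b).
Proof.
have [A1 [A2 [A3 HA]]] := normc_mul3_ge (a 0 0) (b 0 0) (a 0 1) (b 0 1) (a 0 1) (b 0 1).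
have [B1 [B2 [B3 HB]]] := normc_mul3_ge (a 0 0) (b 0 0) (a 0 1) (b 0 1)
  (a 0 1 - a 0 2%:R) (b 0 1 - b 0 2%:R).
have [E1 [E2 [E3 HE]]] := normc_mul3_ge (a 0 0) (b 0 0) (a 0 2%:R) (b 0 2%:R)
  (a 0 2%:R) (b 0 2%:R).
exists (A1 + B1 + E1), (A2 + B2 + E2), (A3 + B3 + E3) => z.
have {HA} := HA z; have {HB} := HB z; have {HE} := HE z.
rewrite !exampleP_products !mxE.
have -> : a 0 1 + z * b 0 1 - (a 0 2%:R + z * b 0 2%:R) =
  a 0 1 - a 0 2%:R + z * (b 0 1 - b 0 2%:R) by ring.
have -> : (A1 + B1 + E1) * z + (A2 + B2 + E2) * z ^+ 2 + (A3 + B3 + E3) * z ^+ 3 =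
  (A1 * z + A2 * z ^+ 2 + A3 * z ^+ 3) + (B1 * z + B2 * z ^+ 2 + B3 * z ^+ 3) +
  (E1 * z + E2 * z ^+ 2 + E3 * z ^+ 3) by ring.
by rewrite !raddfD /=; lra.
Qed.

Lemma expi_continuous : continuous (fun t : R => expi t : C^o).
Proof.
move=> t.
have -> : (fun t : R => expi t : C^o) = (fun t => (cos t +i* 0 : C^o)) + (fun t => (0 +i* sin t : C^o)).
  by apply/funext => u; apply/eqP; rewrite eq_complex /= addr0 add0r !eqxx.
apply: continuousD.
- exact: (@continuous_comp _ _ _ cos (fun s : R => (s +i* 0 : C^o)) t
           (@continuous_cos R t) (@horizontal_continuous R 0 _)).
- exact: (@continuous_comp _ _ _ sin (fun s : R => (0 +i* s : C^o)) t
           (@continuous_sin R t) (@vertical_continuous R 0 _)).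
Qed.

(** A trigonometric polynomial of degree at most 3 has its constant term as mean
    value over a period. *)
Lemma integral_trig_poly (K : R) (D1 D2 D3 : C) :
  (\int[lebesgue_measure]_(t in `[0%R, (2 * pi)%R])
     (K + complex.Re (D1 * expi t + D2 * expi t ^+ 2 + D3 * expi t ^+ 3))%:E
   = (2 * pi * K)%:E)%E /\
  {within `[0%R, (2 * pi)%R], continuous (fun t => K + complex.Re (D1 * expi t + D2 * expi t ^+ 2 + D3 * expi t ^+ 3))}.
Proof.
set f := fun t : R => K + complex.Re _.
have fc : continuous f.
  move=> t; have zc := @expi_continuous t.
  have cM (D : C^o) n : {for t, continuous (fun u => D * expi u ^+ n : C^o)}.
    elim: n => [|n IH]; first exact: cst_continuous.
    rewrite (_ : (fun _ => _) = (fun u => (D * expi u ^+ n) * expi u : C^o)).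
      exact: (continuousM IH zc).
    by apply/funext => u; rewrite exprSr mulrA.
  have pc := continuousD (continuousD (cM D1 1%N) (cM D2 2%N)) (cM D3 3%N).
  have rc := continuous_comp pc (@Re_continuous R _).
  exact: (@continuousD _ R^o _ (fun=> K) _ _ (@cst_continuous _ _ K t) rc).
have fcW : {within `[0%R, (2 * pi)%R], continuous f} by apply: continuous_subspaceT.
split=> //.
(* The primitive of f, term by term: with x = cos t and y = sin t, the real and
   imaginary parts of exp(it)^2 are x^2 - y^2 and 2 x y, with primitives x y
   and y^2; those of exp(it)^3 are x^3 - 3 x y^2 and 3 x^2 y - y^3, with
   primitives x^2 y - y^3 / 3 and x y^2 - x^3 / 3. *)
pose F : R -> R := cst K * id
  + (cst (complex.Re D1) * sin + cst (complex.Im D1) * cos)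
  + (cst (complex.Re D2) * (sin * cos) - cst (complex.Im D2) * (sin * sin))
  + (cst (complex.Re D3) * (sin * cos * cos - cst (3^-1) * (sin * sin * sin))
     + cst (complex.Im D3) * (cst (3^-1) * (cos * cos * cos) - cos * sin * sin)).
have dF t : is_derive t (1 : R) F (f t).
  have ds := @is_derive_sin R t; have dc := @is_derive_cos R t.
  have dk k (g : R -> R) (dg : R) (d : is_derive t (1 : R) g dg) :=
    is_deriveM (@is_derive_cst R R R k t 1) d.
  have d0 := dk K _ _ (@is_derive_id R R t 1).
  have d1 := is_deriveD (dk (complex.Re D1) _ _ ds) (dk (complex.Im D1) _ _ dc).
  have d2 := is_deriveB (dk (complex.Re D2) _ _ (is_deriveM ds dc))
                        (dk (complex.Im D2) _ _ (is_deriveM ds ds)).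
  have dss := is_deriveM (is_deriveM ds ds) ds.
  have dcc := is_deriveM (is_deriveM dc dc) dc.
  have dsc := is_deriveM (is_deriveM ds dc) dc.
  have dcs := is_deriveM (is_deriveM dc ds) ds.
  have d3 := is_deriveD (dk (complex.Re D3) _ _ (is_deriveB dsc (dk 3^-1 _ _ dss)))
                        (dk (complex.Im D3) _ _ (is_deriveB (dk 3^-1 _ _ dcc) dcs)).
  have dall := is_deriveD (is_deriveD (is_deriveD d0 d1) d2) d3.
  apply: (is_derive_eq dall).
  rewrite /f !fctE /GRing.scale /=; clear -D1 D2 D3 K t.
  case: D1 D2 D3 => [a1 b1] [a2 b2] [a3 b3]; move: (cos t) (sin t) => x y.
  rewrite !exprS !expr0 /=.
  by field.
rewrite (@continuous_FTC2 _ f F) //.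
- rewrite -EFinB /F; congr (_%:E).
  rewrite !fctE /= mulr_natl cos2pi sin2pi cos0 sin0; ring.
- by rewrite mulr_gt0 // pi_gt0.
- split=> [t _||]; first exact: ex_derive.
    apply: cvg_at_right_filter; apply: differentiable_continuous.
    by apply/derivable1_diffP; exact: ex_derive.
  apply: cvg_at_left_filter; apply: differentiable_continuous.
  by apply/derivable1_diffP; exact: ex_derive.
- by move=> t _; rewrite derive1E; exact: derive_val.
Qed.

Lemma exampleP_plurisubharmonic : plurisubharmonic (@exampleP R).
Proof.
split=> [a c fac|a b].
  have fa : {for a, continuous (fun x : 'rV[C^o]_3 => exampleP x)}.
    by apply: exampleP_continuous => k; exact: coord_continuous.
  exact: (@cvgr_lt R _ (nbhs (a : 'rV[C^o]_3)) _ (@exampleP R) (exampleP a) fa c fac).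
have [D1 [D2 [D3 D]]] := exampleP_ge a b.
have [int_l lc] := integral_trig_poly (exampleP a) D1 D2 D3.
have uc : {within `[0%R, (2 * pi)%R], continuous (fun t => exampleP (a + expi t *: b))}.
  apply: continuous_subspaceT => t; apply: exampleP_continuous => k.
  rewrite (_ : (fun _ => _) = (fun u => a 0 k + expi u * b 0 k : C^o)); last first.
    by apply/funext => u; rewrite !mxE.
  apply: continuousD; first exact: cst_continuous.
  by apply: continuousM; [exact: expi_continuous | exact: cst_continuous].
have pi2 : (0 : R) < 2 * pi by rewrite mulr_gt0 // pi_gt0.
have -> : (exampleP a)%:E = (((2 * pi)^-1)%:E * (2 * pi * exampleP a)%:E)%E.
  by rewrite -EFinM mulKf // gt_eqF.
apply: lee_wpmul2l; first by rewrite lee_fin invr_ge0 ltW.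
rewrite -int_l; apply: le_integral; first exact: measurable_itv.
- by apply: continuous_compact_integrable lc; exact: segment_compact.
- by apply: continuous_compact_integrable uc; exact: segment_compact.
- by move=> t _; rewrite lee_fin; exact: D.
Qed.

End Plurisubharmonic.

(** * Pluriharmonicity along the level sets of G *)

Section LocallyConstant.
Variable R : realType.

Lemma zero_on_open_near (W : set R[i]^o) (g : R[i]^o -> R) :
  open W -> (forall z, W z -> g z = 0) ->
  forall z, W z -> \forall w \near z, g w = g z.
Proof.
move=> oW g0 z Wz; rewrite (g0 z Wz).
by apply: filterS (open_nbhs_nbhs (conj oW Wz)) => w; exact: g0.
Qed.

Lemma locally_constant_C_on k (W : set R[i]^o) (f : R[i]^o -> R) :
  open W -> (forall z, W z -> \forall w \near z, f w = f z) ->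
  C_on k W f /\ forall z, W z -> partial_x f z = 0 /\ partial_y f z = 0.
Proof.
move=> oW.
have main (g : R[i]^o -> R) : (forall z, W z -> \forall w \near z, g w = g z) ->
  [/\ forall z, W z -> {for z, continuous g},
      forall z, W z -> has_partials g z,
      forall z, W z -> partial_x g z = 0 & forall z, W z -> partial_y g z = 0].
  move=> lc.
  have lx z : W z -> \forall s \near complex.Re z, g z = g (s +i* complex.Im z).
    move=> Wz; have := @horizontal_continuous R (complex.Im z) (complex.Re z).
    have : \forall w \near ((complex.Re z +i* complex.Im z) : R[i]^o), g z = g w.
      by case: z Wz => x y /lc; apply: filterS => w ->.
    by move=> h /(_ _ h).
  have ly z : W z -> \forall s \near complex.Im z, g z = g (complex.Re z +i* s).
    move=> Wz; have := @vertical_continuous R (complex.Re z) (complex.Im z).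
    have : \forall w \near ((complex.Re z +i* complex.Im z) : R[i]^o), g z = g w.
      by case: z Wz => x y /lc; apply: filterS => w ->.
    by move=> h /(_ _ h).
  split=> z Wz.
  - exact: near_cst_continuous (lc z Wz).
  - split; [apply: near_eq_derivable (lx z Wz) _ | apply: near_eq_derivable (ly z Wz) _];
      exact: derivable_cst.
  - rewrite /partial_x -(near_eq_derive _ (lx z Wz)); exact: derive_cst.
  - rewrite /partial_y -(near_eq_derive _ (ly z Wz)); exact: derive_cst.
have zero := zero_on_open_near oW.
elim: k f => [|k IH] f lc; have [c p px py] := main f lc.
  by split=> // z Wz; split; [exact: px|exact: py].
split; last by move=> z Wz; split; [exact: px|exact: py].
split=> //; split=> //.
- by have [] := IH _ (zero _ px).
- by have [] := IH _ (zero _ py).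
Qed.

Lemma locally_constant_harmonic_on (W : set R[i]^o) (f : R[i]^o -> R) :
  open W -> (forall z, W z -> \forall w \near z, f w = f z) -> harmonic_on W f.
Proof.
move=> oW lc; have [cf pf] := locally_constant_C_on 2 oW lc; split=> // z Wz.
have zero := zero_on_open_near oW.
have px := locally_constant_C_on 0 oW (zero _ (fun z Wz => (pf z Wz).1)).
have py := locally_constant_C_on 0 oW (zero _ (fun z Wz => (pf z Wz).2)).
by rewrite (px.2 z Wz).1 (py.2 z Wz).2 addr0.
Qed.

End LocallyConstant.

Section LevelSets.
Variable R : realType.
Local Notation C := R[i].

(** On a level set of G the value of P depends on x only through z w_1 w_2. *)
Lemma exampleP_level (x : 'rV[C]_3) (c : 'rV[C]_2) :
  exampleG x = c ->
  exampleP x = normc (c 0 0) ^+ 2 + normc (c 0 0 - x 0 0 * x 0 1 * x 0 2%:R) ^+ 2 + normc (c 0 1) ^+ 2.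
Proof.
move=> <-; rewrite !mxE /= /exampleP.
have -> : x 0 0 * x 0 1 ^+ 2 - x 0 0 * x 0 1 * x 0 2%:R =
          x 0 0 * (x 0 1 ^+ 2 - x 0 1 * x 0 2%:R) by ring.
by rewrite !normcM; ring.
Qed.

(** A continuous square root s of a nonzero constant is locally constant: near t
    the value s u stays away from - s t, the other root. *)
Lemma sqr_const_locally_constant (T : topologicalType) (K : numFieldType) (W : set T)
    (s : T -> K) (k : K) :
  open W -> (forall t, W t -> {for t, continuous s}) ->
  (forall t, W t -> s t != 0 /\ s t ^+ 2 = k) ->
  forall t, W t -> \forall u \near t, s u = s t.
Proof.
move=> oW sc sk t Wt; have [st0 stk] := sk _ Wt.
have : \forall u \near t, s u + s t != 0.
  apply: (cvgr_neq0 (s t + s t)); last by rewrite -mulr2n mulrn_eq0.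
  by apply: cvgD; [exact: sc|exact: cvg_cst].
apply: filterS2 (open_nbhs_nbhs (conj oW Wt)) => u Wu su; have [_ suk] := sk _ Wu.
by apply/eqP; rewrite -subr_eq0 -(mulIr_eq0 _ (mulIf su)) -subr_sqr suk stk subrr.
Qed.

Lemma exampleP_pluriharmonic (c : 'rV[C^o]_2) :
  pluriharmonic_on (off_coordinate_hyperplanes (n := 3) `&` [set x | exampleG x = c])
    (@exampleP R).
Proof.
move=> W phi oW hphi Mphi; apply: locally_constant_harmonic_on => //.
(* s^2 = c_1 c_2 along phi *)
pose s t : C^o := phi t 0 0 * phi t 0 1 * phi t 0 2%:R.
have phic i t : W t -> {for t, continuous (fun u => phi u 0 i)}.
  by move=> Wt; apply: differentiable_continuous; apply/derivable1_diffP; exact: hphi.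
have sc t : W t -> {for t, continuous s}.
  by move=> Wt; exact: (continuousM (continuousM (phic _ _ Wt) (phic _ _ Wt)) (phic _ _ Wt)).
have sk t : W t -> s t != 0 /\ s t ^+ 2 = c 0 0 * c 0 1.
  move=> /Mphi [n0 <-]; rewrite !mxE /= /s; split; last by ring.
  by rewrite !mulf_neq0.
move=> t Wt; have := sqr_const_locally_constant oW sc sk Wt.
apply: filterS2 (open_nbhs_nbhs (conj oW Wt)) => u Wu su /=.
have [_ cu] := Mphi _ Wu; have [_ ct] := Mphi _ Wt.
by rewrite (exampleP_level cu) (exampleP_level ct) -!/(s _) su.
Qed.

Lemma is_diff_coord (n : nat) (x : 'rV[C^o]_n) (i : 'I_n) :
  is_diff x (fun y : 'rV[C^o]_n => y 0 i : C^o) (fun v => v 0 i).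
Proof.
apply: DiffDef; first exact: differentiable_coord.
have lf : linear (fun v : 'rV[C^o]_n => v 0 i : C^o).
  by move=> a u v; rewrite !mxE.
pose fM := GRing.isLinear.Build _ _ _ _ _ lf.
pose f : {linear _ -> _} := HB.pack (fun v : 'rV[C^o]_n => v 0 i : C^o) fM.
apply: (@diff_lin _ _ _ f); exact: coord_continuous.
Qed.

Lemma is_diff_jacobian (K : numFieldType) (n m : nat) (g dg : 'rV[K]_n -> 'rV[K]_m)
    (x v : 'rV[K]_n) :
  is_diff x g dg -> v *m jacobian g x = dg v.
Proof. by case=> _ dgE; rewrite /jacobian mul_rV_lin1 dgE. Qed.

Lemma is_diffZl (K : numFieldType) (V W : normedModType K) (f df : V -> K) (w : W) (x : V) :
  is_diff x f df -> is_diff x (fun y => f y *: w) (fun v => df v *: w).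
Proof.
move=> dfx; have fx : differentiable f x by exact: ex_diff.
by apply: DiffDef; [exact: differentiableZl | rewrite diffZl // diff_val].
Qed.

Lemma exampleG_jacobian (x : 'rV[C^o]_3) :
  differentiable (@exampleG R : 'rV[C^o]_3 -> 'rV[C^o]_2) x /\
  forall v : 'rV[C^o]_3, v *m jacobian (@exampleG R : 'rV[C^o]_3 -> 'rV[C^o]_2) x =
    \row_j [:: v 0 0 * x 0 1 ^+ 2 + 2 * x 0 0 * x 0 1 * v 0 1;
               v 0 0 * x 0 2%:R ^+ 2 + 2 * x 0 0 * x 0 2%:R * v 0 2%:R]`_j.
Proof.
pose g k (y : 'rV[C^o]_3) : C^o := y 0 k.
pose G k := g 0 * (g k ^+ 2).
have dG k : is_diff x (G k) (fun v => x 0 0 * (2 * x 0 k * v 0 k) + x 0 k ^+ 2 * v 0 0).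
  have d0 := is_diff_coord x 0; have dk := is_diff_coord x k.
  have d2 := is_diffX 1 dk; have dM := is_diffM d0 d2.
  by apply: is_diff_eq; apply/funext => v; rewrite /= expr1.
have GE : @exampleG R = (fun y => G 1 y *: delta_mx 0 0 + G 2%:R y *: delta_mx 0 1).
  apply/funext => y; apply/rowP => j; rewrite !mxE.
  by case: j => -[|[|//]] lt_j /=; rewrite !(mulr0, mulr1, addr0, add0r).
have dGG : is_diff x (@exampleG R : 'rV[C^o]_3 -> 'rV[C^o]_2)
    (fun v => (x 0 0 * (2 * x 0 1 * v 0 1) + x 0 1 ^+ 2 * v 0 0) *: delta_mx 0 0 +
      (x 0 0 * (2 * x 0 2%:R * v 0 2%:R) + x 0 2%:R ^+ 2 * v 0 0) *: delta_mx 0 1).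
  rewrite GE; exact: (is_diffD (is_diffZl _ (dG 1)) (is_diffZl _ (dG 2%:R))).
split=> [|v]; first exact: ex_diff.
rewrite (is_diff_jacobian v dGG) /=; apply/rowP => j; rewrite !mxE.
by case: j => -[|[|//]] lt_j /=; rewrite !(mulr0, mulr1, addr0, add0r); ring.
Qed.

Lemma exampleG_nonsingular (x : 'rV[C^o]_3) :
  off_coordinate_hyperplanes x -> nonsingular_at (@exampleG R) x.
Proof.
move=> x0; have [dG J] := exampleG_jacobian x; split=> //.
apply/eqP; rewrite (_ : minn 3 2 = 2) //; apply/row_fullP.
(* the rows of B are the multiples of d/dw_1 and d/dw_2 that the differential of
   G maps to the standard basis of C^2 *)
pose B : 'M[C^o]_(2, 3) := \matrix_(i, j)
  ((j == lift ord0 i)%:R * (2 * x 0 0 * x 0 j)^-1).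
exists B; apply/row_matrixP => i; rewrite row_mul J.
have two0 : (2 : C) != 0 by rewrite pnatr_eq0.
apply/rowP => j; rewrite !mxE.
case: i => -[|[|//]] lt_i; case: j => -[|[|//]] lt_j /=;
  rewrite ?(mul0r, mul1r, mulr0, add0r, addr0) // divff // !mulf_neq0 // x0.
Qed.

Lemma exampleP_pluriharmonic_along_exampleG :
  pluriharmonic_along_level_sets (off_coordinate_hyperplanes (n := 3))
    (@exampleP R) (@exampleG R).
Proof. by split; [exact: exampleG_nonsingular | exact: exampleP_pluriharmonic]. Qed.

End LevelSets.

(** * Homogeneous polynomials on complex lines *)

Section HomogeneousPolynomials.
Variables (K : comNzRingType) (n : nat).
Implicit Types (F : mpoly n K) (d : nat).

Lemma meval_dhomogZ d F (c : K) (v : 'I_n -> K) :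
  F \is ishomog1 d (@mdeg n) ->
  meval (fun i => c * v i) F = c ^+ d * meval v F.
Proof.
move=> /dhomogP homF; rewrite !mevalE mulr_sumr [LHS]big_seq [RHS]big_seq.
apply: eq_bigr => m /homF mE; rewrite -[d]mE mulrCA; congr (_ * _).
rewrite [X in c ^+ X]mdegE -prodrXr -big_split /=.
by apply: eq_bigr => i _; rewrite exprMn.
Qed.

(** The restriction of F to the line t |-> x + t y, as a polynomial in t. *)
Definition line_poly F (x y : 'I_n -> K) : {poly K} :=
  mmap polyC (fun i => (x i)%:P + y i *: 'X) F.

Lemma horner_line_poly F x y t :
  (line_poly F x y).[t] = meval (fun i => x i + t * y i) F.
Proof.
rewrite /line_poly mevalE /mmap horner_sum; apply: eq_bigr => m _.
rewrite hornerM hornerC; congr (_ * _); rewrite horner_prod.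
by apply: eq_bigr => i _; rewrite !hornerE mulrC.
Qed.

Lemma coef0_line_poly F x y : (line_poly F x y)`_0 = meval x F.
Proof.
by rewrite -horner_coef0 horner_line_poly; apply: meval_eq => i; rewrite mul0r addr0.
Qed.

(** The coefficient of the top possible degree is multiplicative; a and b bound the
    degrees of p and q. *)
Lemma size_mul_coef_top (p q : {poly K}) a b :
  (size p <= a.+1)%N -> (size q <= b.+1)%N ->
  (size (p * q)%R <= (a + b).+1)%N /\ (p * q)`_(a + b) = p`_a * q`_b.
Proof.
move=> sp sq; split.
  apply: leq_trans (size_polyMleq _ _) _.
  by rewrite -ltnS; case: (size p + size q)%N (leq_add sp sq) => // k; rewrite addnS addSn.
rewrite coefM (bigD1 (inord a)) //= inordK ?ltnS ?leq_addr // addKn.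
rewrite big1 ?addr0 // => i; rewrite -val_eqE /= inordK ?ltnS ?leq_addr // => ia.
have := ltn_ord i; rewrite ltnS => ile.
case: (ltngtP i a) ia => // ia _.
  rewrite [q`_ _]nth_default ?mulr0 //; apply: leq_trans sq _.
  by rewrite ltn_subRL ltn_add2r.
by rewrite nth_default ?mul0r //; apply: leq_trans sp _.
Qed.

Lemma line_poly_monomial (m : multinom n) (x y : 'I_n -> K) :
  (size (mmap1 (fun i => (x i)%:P + y i *: 'X)%R m) <= (mdeg m).+1)%N /\
  (mmap1 (fun i => (x i)%:P + y i *: 'X) m)`_(mdeg m) = \prod_i y i ^+ m i.
Proof.
pose L i : {poly K} := (x i)%:P + y i *: 'X.
have Hexp i k : (size (L i ^+ k : {poly K}) <= k.+1)%N /\ (L i ^+ k)`_k = y i ^+ k.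
  elim: k => [|k [IH1 IH2]]; first by rewrite !expr0 size_poly1 coef1.
  rewrite !exprS.
  have s1 : (size (L i) <= 2)%N.
    rewrite (leq_trans (size_polyD _ _)) // geq_max.
    rewrite (leq_trans (size_polyC_leq1 _)) //.
    by rewrite (leq_trans (size_scale_leq _ _)) // size_polyX.
  have [] := size_mul_coef_top s1 IH1; rewrite add1n => -> ->; split=> //.
  by rewrite IH2 coefD coefC coefZ coefX mulr1 add0r.
pose P (p : {poly K}) k c := (size p <= k.+1)%N /\ p`_k = c.
suff: P (\prod_i L i ^+ m i) (\sum_i m i)%N (\prod_i y i ^+ m i) by rewrite -mdegE.
apply: (big_ind3 P).
- by rewrite /P size_poly1 coef1.
- move=> p1 k1 c1 p2 k2 c2 [s1 e1] [s2 e2].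
  by rewrite /P; have [-> ->] := size_mul_coef_top s1 s2; rewrite e1 e2.
- by move=> i _; apply: Hexp.
Qed.

(** The coefficient of t^d in F(x + t y) is F(y). *)
Lemma line_poly_dhomog d F x y : F \is ishomog1 d (@mdeg n) ->
  (size (line_poly F x y) <= d.+1)%N /\ (line_poly F x y)`_d = meval y F.
Proof.
move=> /dhomogP homF; rewrite /line_poly mevalE /mmap; split.
  rewrite big_seq; apply: (big_ind (fun p : {poly K} => (size p <= d.+1)%N)).
  - by rewrite size_poly0.
  - by move=> p q sp sq; rewrite (leq_trans (size_polyD _ _)) // geq_max sp.
  - move=> m /homF <-; rewrite mul_polyC (leq_trans (size_scale_leq _ _)) //.
    by have [] := line_poly_monomial m x y.
rewrite coef_sum [LHS]big_seq [RHS]big_seq; apply: eq_bigr => m /homF <-.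
by rewrite mul_polyC coefZ; have [_ ->] := line_poly_monomial m x y.
Qed.

Lemma dhomog2_bilinear F : F \is ishomog1 2 (@mdeg n) ->
  exists C : 'I_n -> 'I_n -> K,
    forall v, meval v F = \sum_i \sum_j C i j * (v i * v j).
Proof.
move=> /dhomogP homF.
suff [C HC] : exists C : 'I_n -> 'I_n -> K, forall v : 'I_n -> K,
    \sum_(m <- msupp F) mcoeff m F * \prod_i v i ^+ m i
      = \sum_i \sum_j C i j * (v i * v j).
  by exists C => v; rewrite mevalE.
elim: (msupp F) homF => [|m s IH] homF.
  exists (fun _ _ => 0) => v; rewrite big_nil big1 // => i _.
  by rewrite big1 // => j _; rewrite mul0r.
have [C HC] : exists C : 'I_n -> 'I_n -> K, forall v : 'I_n -> K,
    \sum_(m <- s) mcoeff m F * \prod_i v i ^+ m i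
      = \sum_i \sum_j C i j * (v i * v j).
  by apply: IH => k ks; apply: homF; rewrite inE ks orbT.
have m2 : mdeg m = 2%N by apply: homF; rewrite inE eqxx.
(* a monomial of degree 2 is a product of two variables *)
have [i mi] : exists i, m i != 0%N.
  apply/existsP; apply: contra_eqT m2; rewrite negb_exists => /forallP m0.
  rewrite mdegE big1 // => i _; exact/eqP/negbNE/m0.
pose m' := mnm_sub m (mnm1 i).
have mE : m = mnm_add m' (mnm1 i).
  apply/mnmP => k; rewrite mnmDE mnmBE mnm1E subnK //.
  by case: eqP => // <-; rewrite lt0n.
have /mdeg1P[j /eqP m'j] : mdeg m' == 1%N.
  by move: m2; rewrite {1}mE mdegD mdeg1 addn1 => -[->].
have XE (v : 'I_n -> K) : \prod_k v k ^+ m k = v i * v j.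
  rewrite -(mevalX v m) mE m'j mpolyXD mevalM !mevalXU; exact: mulrC.
exists (fun a b => C a b + mcoeff m F * ((a == i) && (b == j))%:R) => v.
rewrite big_cons XE HC addrC.
rewrite [X in _ + X](_ : _ = \sum_a \sum_b (mcoeff m F * ((a == i) && (b == j))%:R) * (v a * v b)).
  rewrite -big_split; apply: eq_bigr => a _; rewrite -big_split /=.
  by apply: eq_bigr => b _; rewrite mulrDl.
rewrite (bigD1 i) //= [X in _ + X]big1 => [|a /negbTE ->]; last first.
  by rewrite big1 // => b _; rewrite mulr0 mul0r.
rewrite addr0 (bigD1 j) //= big1 ?addr0 ?eqxx ?mulr1 // => b /negbTE ->.
by rewrite andbF mulr0 mul0r.
Qed.

End HomogeneousPolynomials.

Lemma exists_left_kernel (K : fieldType) (m n : nat) (M : 'M[K]_(m, n)) :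
  (n < m)%N -> exists2 c : 'rV_m, c != 0 & c *m M = 0.
Proof.
move=> nm; have : kermx M != 0.
  by rewrite kermx_eq0 /row_free ltn_eqF // (leq_ltn_trans (rank_leq_col M)).
move=> /rowV0Pn[c /sub_kermxP cM c0].
by exists c.
Qed.

(** * Polarization of sesquilinear identities *)

Section Polarization.
Variable R : realType.
Local Notation C := R[i].

Lemma poly_unit_circle_eq0 (p : {poly C}) :
  (forall u : C, u * u^*%C = 1 -> p.[u] = 0) -> p = 0.
Proof.
move=> p0; apply/eqP/negPn/negP => pN0.
(* infinitely many points of the unit circle, by the Cayley transform *)
pose c (k : nat) : C := (1 +i* k%:R) / (1 -i* k%:R).
have dN0 (k : nat) : (1 -i* k%:R : C) != 0.
  by apply/eqP => -[/eqP]; rewrite oner_eq0.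
have c_inj : injective c.
  move=> k l /eqP; rewrite /c eqr_div // => /eqP [_ h].
  apply/eqP; rewrite -(eqr_nat R); apply/eqP; lra.
have c_circle k : c k * (c k)^*%C = 1.
  have E : (1 -i* k%:R : C) = (1 +i* k%:R)^*%C by [].
  have cM (a b : C) : (a * b)^*%C = a^*%C * b^*%C by exact: rmorphM.
  have nN0 : (1 +i* k%:R : C) != 0 by rewrite -conjc_eq0 dN0.
  rewrite /c cM conjc_inv E conjcK mulrACA -invfM [X in _ / X]mulrC divff //.
  by rewrite mulf_neq0 // -E.
suff: (size [seq c k | k <- iota 0 (size p)] < size p)%N.
  by rewrite size_map size_iota ltnn.
apply: max_poly_roots => //; last by rewrite map_inj_uniq // iota_uniq.
by apply/allP => _ /mapP[k _ ->]; apply/rootP/p0.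
Qed.

(** The polynomial u^d conj(p(1 / conj(u))), which on the unit circle equals
    u^d conj(p(u)). *)
Definition conj_rev_poly d (p : {poly C}) : {poly C} :=
  \poly_(i < d.+1) (p`_(d - i))^*%C.

Lemma horner_conj_rev_poly d (p : {poly C}) u :
  (size p <= d.+1)%N -> u * u^*%C = 1 ->
  (conj_rev_poly d p).[u] = u ^+ d * (p.[u])^*%C.
Proof.
move=> sp uu; rewrite horner_poly (horner_coef_wide _ sp) rmorph_sum mulr_sumr.
rewrite (reindex_inj rev_ord_inj) /=; apply: eq_bigr => i _.
rewrite subSS subKn -1?ltnS // rmorphM rmorphXn mulrCA; congr (_ * _).
have -> : u ^+ d = u ^+ (d - i) * u ^+ i by rewrite -exprD subnK // -ltnS.
by rewrite -mulrA -exprMn uu expr1n mulr1.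
Qed.

Variables (n d : nat).

(** A polynomial in u that on the unit circle equals
    u^d A(x + u y) conj(B(x + u y)). *)
Definition sesqui_line_poly (A B : mpoly n C) (x y : 'I_n -> C) : {poly C} :=
  line_poly A x y * conj_rev_poly d (line_poly B x y).

Lemma horner_sesqui_line_poly A B x y u :
  A \is ishomog1 d (@mdeg n) -> B \is ishomog1 d (@mdeg n) -> u * u^*%C = 1 ->
  let v i := x i + u * y i in
  (sesqui_line_poly A B x y).[u] = u ^+ d * (meval v A * (meval v B)^*%C).
Proof.
move=> hA hB uu v; rewrite hornerM horner_conj_rev_poly //; last first.
  by have [] := line_poly_dhomog x y hB.
by rewrite !horner_line_poly mulrCA.
Qed.

Lemma coef_sesqui_line_poly A B x y :
  A \is ishomog1 d (@mdeg n) -> B \is ishomog1 d (@mdeg n) ->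
  (sesqui_line_poly A B x y)`_(d + d) = meval y A * (meval x B)^*%C.
Proof.
move=> hA hB; have [sA cA] := line_poly_dhomog x y hA.
have sB : (size (conj_rev_poly d (line_poly B x y)) <= d.+1)%N by exact: size_poly.
have [_ ->] := size_mul_coef_top sA sB.
by rewrite cA coef_poly leqnn subnn coef0_line_poly.
Qed.

(** An identity between sesquilinear expressions in homogeneous polynomials that
    holds on the diagonal holds for independent arguments: compare the
    coefficients of u^(2d) in the identity at x + u y, |u| = 1. *)
Lemma polarization (I J : finType) (A B : I -> mpoly n C) (A' B' : J -> mpoly n C) :
  (forall i, A i \is ishomog1 d (@mdeg n)) ->
  (forall i, B i \is ishomog1 d (@mdeg n)) ->
  (forall j, A' j \is ishomog1 d (@mdeg n)) ->
  (forall j, B' j \is ishomog1 d (@mdeg n)) ->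
  (forall v, \sum_i meval v (A i) * (meval v (B i))^*%C =
             \sum_j meval v (A' j) * (meval v (B' j))^*%C) ->
  forall x y, \sum_i meval y (A i) * (meval x (B i))^*%C =
              \sum_j meval y (A' j) * (meval x (B' j))^*%C.
Proof.
move=> hA hB hA' hB' diag x y.
have : \sum_i sesqui_line_poly (A i) (B i) x y -
       \sum_j sesqui_line_poly (A' j) (B' j) x y = 0.
  apply: poly_unit_circle_eq0 => u uu; rewrite hornerD hornerN !horner_sum.
  apply/eqP; rewrite subr_eq0; apply/eqP.
  under eq_bigr do rewrite horner_sesqui_line_poly //.
  under [RHS]eq_bigr do rewrite horner_sesqui_line_poly //.
  by rewrite -!mulr_sumr diag.
move/(congr1 (fun p : {poly C} => p`_(d + d))); rewrite coefB coef0 !coef_sum.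
move/eqP; rewrite subr_eq0 => /eqP.
under eq_bigr do rewrite coef_sesqui_line_poly //.
by under [RHS]eq_bigr do rewrite coef_sesqui_line_poly //.
Qed.

End Polarization.

(** * P does not factor through two homogeneous polynomials *)

Section HermitianSquares.
Variable R : realType.
Local Notation C := R[i].

(** The holomorphic polynomials h_k with P = |h_0|^2 + |h_1|^2 + |h_2|^2. *)
Definition exampleH (k : 'I_3) : mpoly 3 C :=
  let z := mpolyX C (mnm1 0) in
  let w1 := mpolyX C (mnm1 1) in let w2 := mpolyX C (mnm1 2%:R) in
  [:: z * w1 ^+ 2; z * (w1 ^+ 2 - w1 * w2); z * w2 ^+ 2]`_k.

Lemma exampleH_dhomog k : exampleH k \is ishomog1 3 (@mdeg 3).
Proof.
have hX i : mpolyX C (mnm1 i) \is ishomog1 1 (@mdeg 3) by rewrite dhomogX; apply/eqP/mdeg1.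
have hM := @dhomogM 3 C mdeg 1 _ 2 _ (hX 0).
case: k => -[|[|[|//]]] lt_k; rewrite /exampleH /=; apply: hM.
- exact: (dhomogMn 2 (hX _)).
- by rewrite rpredB // ?(dhomogMn 2 (hX _)) // (@dhomogM _ _ mdeg 1 _ 1).
- exact: (dhomogMn 2 (hX _)).
Qed.

Lemma meval_exampleH (v : 'I_3 -> C) :
  [/\ meval v (exampleH 0) = v 0 * v 1 ^+ 2,
      meval v (exampleH 1) = v 0 * (v 1 ^+ 2 - v 1 * v 2%:R) &
      meval v (exampleH 2%:R) = v 0 * v 2%:R ^+ 2].
Proof. by split; rewrite /exampleH /= ?expr2 !(mevalM, mevalB, mevalXU). Qed.

Lemma exampleP_sum (x : 'rV[C]_3) :
  (exampleP x)%:C = \sum_k meval (x 0) (exampleH k) * (meval (x 0) (exampleH k))^*%C.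
Proof.
have [e0 e1 e2] := meval_exampleH (x 0).
rewrite sum_ord3 {}e0 {}e1 {}e2.
have -> : x 0 0 * (x 0 1 ^+ 2 - x 0 1 * x 0 2%:R) = x 0 0 * x 0 1 * (x 0 1 - x 0 2%:R) by ring.
by rewrite -!normc_sqr -!raddfD exampleP_products !normcM; congr (_%:C); ring.
Qed.

End HermitianSquares.

Section NoFactorization.
Variable R : realType.
Local Notation C := R[i].
Local Notation i := ('i : C)%C.
Local Notation row3 := (@row3 R).

Lemma holo_map_scale n k d (F : 'I_k -> mpoly n C) (c : C) x :
  (forall j, F j \is ishomog1 d (@mdeg n)) ->
  holo_map F (c *: x) = c ^+ d *: holo_map F x.
Proof.
move=> hF; apply/rowP => j; rewrite !mxE -meval_dhomogZ //.
by apply: meval_eq => l; rewrite mxE.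
Qed.

Lemma holo_mapD n k (F : 'I_k -> mpoly n C) x y :
  (forall j, F j \is ishomog1 1 (@mdeg n)) ->
  holo_map F (x + y) = holo_map F x + holo_map F y.
Proof.
move=> hF; apply/rowP => j; rewrite !mxE.
have [sp cp] := line_poly_dhomog (x 0) (y 0) (hF j).
have := horner_line_poly (F j) (x 0) (y 0) 1.
rewrite (horner_coef_wide _ sp) !big_ord_recl big_ord0 addr0 /= cp coef0_line_poly.
rewrite !expr1n !mulr1 => ->; apply: meval_eq => l.
by rewrite mxE mul1r.
Qed.

Section EvalScale.
Variables (n e : nat) (q : zzbar_poly R n) (Q : 'rV[C]_n -> R).
Hypothesis (qQ : expands q Q) (hq : q \is ishomog1 e (@mdeg (n + n))).

Lemma expands_scale (r : R) v : Q (r%:C *: v) = r ^+ e * Q v.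
Proof.
apply: (@complexI R); rewrite -qQ rmorphM rmorphXn /= -qQ /eval_zzbar.
rewrite -(meval_dhomogZ _ _ hq); apply: meval_eq => j.
rewrite !mxE; case: splitP => k _; rewrite !mxE //.
by rewrite -[in RHS](conjc_real r) -[RHS]rmorphM.
Qed.

End EvalScale.

(** For Q homogeneous of degree 2, the terms z_a z_b and conj(z_a) conj(z_b) change
    sign under v |-> i v and the terms z_a conj(z_b) are invariant, so that
    Q(v) + Q(iv) is sesquilinear. *)
Lemma expands_quadratic_hermitian (n : nat) (q : zzbar_poly R n) (Q : 'rV[C]_n -> R) :
  expands q Q -> q \is ishomog1 2 (@mdeg (n + n)) ->
  exists H : 'I_n -> 'I_n -> C, forall v : 'rV[C]_n,
    (Q v + Q (i *: v))%:C = (\sum_b (\sum_a H a b * v 0 a) * (v 0 b)^*%C) *+ 2.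
Proof.
move=> qQ /dhomog2_bilinear[c qE].
exists (fun a b => c (lshift n a) (rshift n b) + c (rshift n b) (lshift n a)) => v.
rewrite rmorphD /= -!qQ /eval_zzbar !qE.
set V := (X in \sum_i \sum_j _ * (X i * X j) + _).
set W := (X in _ + \sum_i \sum_j _ * (X i * X j)).
have Vl a : V (lshift n a) = v 0 a by rewrite /V row_mxEl.
have Vr a : V (rshift n a) = (v 0 a)^*%C by rewrite /V row_mxEr mxE.
have Wl a : W (lshift n a) = i * v 0 a by rewrite /W row_mxEl mxE.
have Wr a : W (rshift n a) = - i * (v 0 a)^*%C.
  by rewrite /W row_mxEr mxE mxE; case: (v 0 a) => x y; simpc.
have ii : i * i = -1 by rewrite -expr2 sqr_i.
rewrite -big_split /= big_split_ord /=.
rewrite [X in X + _](_ : _ = \sum_b (\sum_a c (lshift n a) (rshift n b) * v 0 a) * (v 0 b)^*%C *+ 2); last first.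
  rewrite (eq_bigr (fun a => \sum_b (c (lshift n a) (rshift n b) * (V (lshift n a) * V (rshift n b)) +
      c (lshift n a) (rshift n b) * (W (lshift n a) * W (rshift n b))))) => [|a _]; last first.
    rewrite -big_split big_split_ord /= big1 ?add0r // => b _.
    by rewrite !Vl !Wl mulrACA ii; ring.
  rewrite exchange_big /=; apply: eq_bigr => b _.
  rewrite mulr_suml -sumrMnl; apply: eq_bigr => a _.
  by rewrite Vl Vr Wl Wr mulNr mulrN mulrACA ii; ring.
rewrite [X in _ + X](_ : _ = \sum_b (\sum_a c (rshift n b) (lshift n a) * v 0 a) * (v 0 b)^*%C *+ 2); last first.
  apply: eq_bigr => b _.
  rewrite -big_split big_split_ord /= [X in _ + X]big1 ?addr0 => [|a _]; last first.
    by rewrite !Vr !Wr mulrACA mulrNN ii; ring.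
  rewrite mulr_suml -sumrMnl; apply: eq_bigr => a _.
  by rewrite Vl Vr Wl Wr mulrACA mulNr ii; ring.
rewrite -big_split -sumrMnl; apply: eq_bigr => b _ /=.
rewrite -mulrnDl -mulrDl -big_split; congr (_ * _ *+ _).
by apply: eq_bigr => a _; rewrite mulrDl.
Qed.

Section Factorization.
Variables (Q : 'rV[C]_2 -> R) (q : zzbar_poly R 2) (e d : nat).
Variable (F : 'I_2 -> mpoly 3 C).
Hypotheses (qQ : expands q Q) (hq : q \is ishomog1 e (@mdeg (2 + 2))).
Hypothesis (hF : forall j, F j \is ishomog1 d (@mdeg 3)).
Hypothesis (PQF : forall x : 'rV[C]_3, exampleP x = Q (holo_map F x)).

(** Compare P(2 x) with Q(F(2 x)). *)
Lemma factor_degree : (d * e = 6)%N.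
Proof.
have : exampleP (2%:C *: row3 1 1 0) = 2 ^+ 6 * exampleP (row3 1 1 0).
  by rewrite exampleP_scale /= expr0n addr0 sqrtr_sqr normr_nat.
rewrite PQF (holo_map_scale _ _ hF) -rmorphXn (expands_scale qQ hq) -PQF exampleP_row110.
have two0 : (2 : R) != 0 by rewrite pnatr_eq0.
move/(mulIf two0); rewrite -exprM => /eqP.
by rewrite -!natrX eqr_nat eqn_exp2l // => /eqP.
Qed.

(** If i^d = -1, then P(x) = P(i x) = Q(- F(x)), so e is even. *)
Lemma factor_even (k : nat) : d = (2 * k)%N -> odd k -> ~~ odd e.
Proof.
move=> dk ok; apply/negP => oe.
have id : i ^+ d = (-1)%:C.
  by rewrite dk exprM sqr_i -signr_odd ok rmorphN.
have := exampleP_scale i (row3 1 1 0); rewrite normc_i expr1n mul1r.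
rewrite PQF (holo_map_scale _ _ hF) id (expands_scale qQ hq) -PQF exampleP_row110.
by rewrite -signr_odd oe; lra.
Qed.

Lemma factor_not_linear : d != 1%N.
Proof.
apply/eqP => d1.
have hF1 j : F j \is ishomog1 1 (@mdeg 3) by have := hF j; rewrite d1.
pose M : 'M[C]_(3, 2) := \matrix_(k < 3) holo_map F (delta_mx 0 k).
(* c is a nonzero vector with F(c) = 0, so P(x + c) = P(x) for all x *)
have [c c0 cM] := exists_left_kernel M isT.
have Fc : holo_map F c = 0.
  rewrite -[RHS]cM mulmx_sum_row {1}[c]row_sum_delta.
  have F0 : holo_map F 0 = 0.
    by rewrite -[X in holo_map F X](scale0r 0) (holo_map_scale _ _ hF1) expr1 scale0r.
  rewrite (big_morph _ (fun x y => holo_mapD x y hF1) F0).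
  by apply: eq_bigr => k _; rewrite (holo_map_scale _ _ hF1) expr1 rowK.
have Pc x : exampleP (x + c) = exampleP x by rewrite !PQF holo_mapD // Fc addr0.
have cE : c = row3 (c 0 0) (c 0 1) (c 0 2%:R).
  by apply/rowP => j; rewrite mxE; case: (ord3P j) => ->.
have row3D a b c' x y z : row3 a b c' + row3 x y z = row3 (a + x) (b + y) (c' + z).
  by apply/rowP => j; rewrite !mxE; case: (ord3P j) => ->.
move: c0 Pc; rewrite cE; move: (c 0 0) (c 0 1) (c 0 2%:R) => a b b' c0 Pc.
have normc0_eq (z : C) n : normc z ^+ n.+1 = 0 -> z = 0.
  by move/eqP; rewrite expf_eq0 /= => /eqP/ComplexField.Normc.eq0_normc.
have normc_ge0 (z : C) : 0 <= normc z by case: z => u v; exact: sqrtr_ge0.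
have sum0 (z w t : C) : normc z ^+ 4 + normc w ^+ 2 + normc t ^+ 4 = 0 -> z = 0 /\ t = 0.
  have := exprn_ge0 4 (normc_ge0 z); have := exprn_ge0 2 (normc_ge0 w).
  have := exprn_ge0 4 (normc_ge0 t) => h1 h2 h3 h.
  by split; apply: (@normc0_eq _ 3); lra.
have [b0 b'0] : b = 0 /\ b' = 0.
  have := Pc (row3 (1 - a) 0 0); rewrite row3D subrK !add0r !exampleP_row3.
  rewrite (ComplexField.Normc.normc1 R) expr1n mul1r mul0r expr0n subr0 (ComplexField.Normc.normc0 R).
  by rewrite !expr0n !addr0 mulr0 => /sum0.
have a0 : a = 0.
  have := Pc (row3 0 1 0); rewrite row3D b0 b'0 add0r !addr0 !exampleP_row3.
  rewrite mulr0 subr0 !expr1n (ComplexField.Normc.normc1 R) (ComplexField.Normc.normc0 R).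
  rewrite !expr0n mul0r addr0 !expr1n => /eqP; rewrite mulf_eq0.
  by rewrite -[_ + _]/(2%:R) pnatr_eq0 orbF => /eqP/(@normc0_eq _ _).
case/eqP: c0; apply/rowP => j; rewrite !mxE a0 b0 b'0.
by case: (ord3P j) => ->.
Qed.

Lemma factor_not_quadratic : d = 3 -> e != 2.
Proof.
move=> d3; apply/eqP => e2.
have hq2 : q \is ishomog1 2 (@mdeg (2 + 2)) by have := hq; rewrite e2.
have hF3 j : F j \is ishomog1 3 (@mdeg 3) by have := hF j; rewrite d3.
have [H QH] := expands_quadratic_hermitian qQ hq2.
pose G b : mpoly 3 C := \sum_a H a b *: F a.
have hG b : G b \is ishomog1 3 (@mdeg 3) by apply: rpred_sum => a _; apply: rpredZ; exact: hF3.
have GE v b : meval v (G b) = \sum_a H a b * meval v (F a).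
  by rewrite /G raddf_sum; apply: eq_bigr => a _; rewrite /= mevalZ.
have diag v : \sum_k meval v (exampleH R k) * (meval v (exampleH R k))^*%C =
              \sum_b meval v (G b) * (meval v (F b))^*%C.
  pose x : 'rV[C]_3 := \row_j v j.
  have vx (p : mpoly 3 C) : meval v p = meval (x 0) p.
    by apply: meval_eq => j; rewrite mxE.
  under eq_bigr do rewrite vx; rewrite -exampleP_sum.
  have := QH (holo_map F x).
  (* (- i)^3 = i, so that F(- i x) = i F(x), while P(- i x) = P(x) *)
  have -> : i = (- i) ^+ 3.
    by rewrite exprSr sqrrN sqr_i mulrN mulN1r opprK.
  rewrite -(holo_map_scale _ _ hF3) -!PQF exampleP_scale.
  have -> : normc (- i) = 1.
    by rewrite /= oppr0 expr0n sqrrN expr1n add0r sqrtr1.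
  rewrite expr1n mul1r -mulr2n rmorphMn /= => /eqP.
  rewrite eqr_pMn2r // => /eqP ->.
  apply: eq_bigr => b _; rewrite mxE !vx GE; congr (_ * _).
  by apply: eq_bigr => a _; rewrite mxE.
have pol := polarization (@exampleH_dhomog R) (@exampleH_dhomog R) hG hF3 diag.
(* three points at which the vectors (h_0, h_1, h_2) are independent, and a
   relation c between the values of F there *)
pose X (k : 'I_3) : 'rV[C]_3 := [:: row3 1 1 0; row3 1 0 1; row3 1 1 1]`_k.
pose M : 'M[C]_(3, 2) := \matrix_(k < 3) holo_map F (X k).
have [c c0 cM] := exists_left_kernel M isT.
(* S is the same combination of the values of h; by the polarized identity it is
   orthogonal to all values of h *)
pose S k := \sum_l c 0 l * meval (X l 0) (exampleH R k).
have S0 y : \sum_k meval y (exampleH R k) * (S k)^*%C = 0.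
  rewrite (eq_bigr (fun k => \sum_l (c 0 l)^*%C *
      (meval y (exampleH R k) * (meval (X l 0) (exampleH R k))^*%C))) => [|k _]; last first.
    rewrite /S rmorph_sum mulr_sumr; apply: eq_bigr => l _.
    by rewrite rmorphM mulrCA.
  rewrite exchange_big (eq_bigr (fun l => \sum_b (c 0 l)^*%C *
      (meval y (G b) * (meval (X l 0) (F b))^*%C))) => [|l _]; last first.
    by rewrite -!mulr_sumr pol.
  rewrite exchange_big big1 // => b _.
  transitivity (meval y (G b) * ((c *m M) 0 b)^*%C).
    rewrite mxE; move: (meval y (G b)) => g.
    rewrite rmorph_sum mulr_sumr; apply: eq_bigr => l _.
    by rewrite !mxE rmorphM mulrCA.
  by rewrite cM mxE conjc0 mulr0.
have hE (x y z : C) : [/\ meval (row3 x y z 0) (exampleH R 0) = x * y ^+ 2,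
    meval (row3 x y z 0) (exampleH R 1) = x * (y ^+ 2 - y * z) &
    meval (row3 x y z 0) (exampleH R 2%:R) = x * z ^+ 2].
  have := meval_exampleH (row3 x y z 0).
  have [-> -> ->] // : [/\ row3 x y z 0 0 = x, row3 x y z 0 1 = y & row3 x y z 0 2%:R = z].
  by split; rewrite mxE.
have lin (x y z : C) : x * y ^+ 2 * (S 0)^*%C + x * (y ^+ 2 - y * z) * (S 1)^*%C
    + x * z ^+ 2 * (S 2%:R)^*%C = 0.
  have [h0 h1 h2] := hE x y z; rewrite -[RHS](S0 (row3 x y z 0)) sum_ord3.
  by congr (_ * _ + _ * _ + _ * _).
have SE k : S k = c 0 0 * meval (row3 1 1 0 0) (exampleH R k)
    + c 0 1 * meval (row3 1 0 1 0) (exampleH R k)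
    + c 0 2%:R * meval (row3 1 1 1 0) (exampleH R k).
  by rewrite /S sum_ord3.
have [a0 a1 a2] := hE 1 1 0; have [b0 b1 b2] := hE 1 0 1; have [d0 d1 d2] := hE 1 1 1.
(* at (1,1,0), (1,0,1), (1,1,1) the vector h is (1,1,0), (0,0,1), (1,0,1) *)
have [S00 S1 S2] : [/\ S 0 = 0, S 1 = 0 & S 2%:R = 0].
  move: lin; move: (S 0) (S 1) (S 2%:R) => s0 s1 s2 lin.
  have conj0 (s : C) : s^*%C = 0 -> s = 0 by move/eqP; rewrite conjc_eq0 => /eqP.
  have s2_0 : s2^*%C = 0 by rewrite -(lin 1 0 1); ring.
  have s0_0 : s0^*%C = 0 by rewrite -(lin 1 1 1) s2_0; ring.
  have s1_0 : s1^*%C = 0 by rewrite -(lin 1 1 0) s2_0 s0_0; ring.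
  by split; apply: conj0.
rewrite SE a2 b2 d2 in S2; rewrite SE a0 b0 d0 in S00; rewrite SE a1 b1 d1 in S1.
case/eqP: c0; apply/rowP => j; rewrite mxE.
have c00 : c 0 0 = 0 by rewrite -[RHS]S1; ring.
have c02 : c 0 2%:R = 0 by rewrite -[RHS]S00 c00; ring.
have c01 : c 0 1 = 0 by rewrite -[RHS]S2 c02; ring.
by case: (ord3P j) => ->.
Qed.

End Factorization.
End NoFactorization.

Lemma exampleP_not_factor (R : realType) :
  ~ (exists (Q : 'rV[R[i]]_2 -> R) (q : zzbar_poly R 2)
       (F : 'I_2 -> mpoly 3 R[i]) (d : nat),
       [/\ expands q Q,
           homogeneous_poly q,
           forall j, F j \is ishomog1 d (@mdeg 3) &
           forall x : 'rV[R[i]]_3, @exampleP R x = Q (holo_map F x)]).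
Proof.
move=> [Q [q [F [d [qQ [e hq] hF PQF]]]]].
have de := factor_degree qQ hq hF PQF.
have nlin := factor_not_linear hF PQF.
have even := factor_even qQ hq hF PQF.
have nquad := factor_not_quadratic qQ hq hF PQF.
have : (d <= 6)%N by rewrite dvdn_leq // -de dvdn_mulr.
case: d de nlin even nquad {hF} => [|[|[|[|[|[|[|//]]]]]]] de nlin even nquad _.
- by [].
- by [].
- have e3 : e = 3 by apply/eqP; rewrite -(eqn_pmul2l (isT : 0 < 2)%N) de.
  by have := even 1 erefl isT; rewrite e3.
- have e2 : e = 2 by apply/eqP; rewrite -(eqn_pmul2l (isT : 0 < 3)%N) de.
  by have := nquad erefl; rewrite e2.
- by have : (4 %| 6)%N by rewrite -de dvdn_mulr.
- by have : (5 %| 6)%N by rewrite -de dvdn_mulr.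
- have e1 : e = 1 by apply/eqP; rewrite -(eqn_pmul2l (isT : 0 < 6)%N) de.
  by have := even 3 erefl isT; rewrite e1.
Qed.

Unset Implicit Arguments.

Theorem proposition2p2 (R : realType) :
  (exists2 p : zzbar_poly R 3, expands p (@exampleP R) &
     [/\ nonconstant (@exampleP R),
         homogeneous_poly p,
         plurisubharmonic (@exampleP R),
         without_pluriharmonic_terms p &
         homogeneous_in_variables 1 p]) /\
  pluriharmonic_along_level_sets (off_coordinate_hyperplanes (n := 3))
    (@exampleP R) (@exampleG R) /\
  ~ (exists (Q : 'rV[R[i]]_2 -> R) (q : zzbar_poly R 2)
       (F : 'I_2 -> mpoly 3 R[i]) (d : nat),
       [/\ expands q Q,
           homogeneous_poly q,
           plurisubharmonic Q,
           forall j, F j \is ishomog1 d (@mdeg 3) &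
           forall x : 'rV[R[i]]_3, @exampleP R x = Q (holo_map F x)]).
Proof.
split; [|split].
- have [homP pluriP varP] := @exampleP_poly_properties R.
  exists (exampleP_poly R); first exact: exampleP_poly_expands.
  split=> //; [exact: exampleP_nonconstant | exact: exampleP_plurisubharmonic].
- exact: exampleP_pluriharmonic_along_exampleG.
- move=> [Q [q [F [d [qQ hq _ hF PQF]]]]].
  by apply: (@exampleP_not_factor R); exists Q, q, F, d.
Qed.
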